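(* Let $f,g:[a,b]\to\mathbb{R}$ be absolutely $\beta$-integrable functions on $[a,b]$, and suppose that there exist real numbers $m,n,M,N$ such that $$m\le f(x)\le M,\qquad n\le g(x)\le N\qquad\text{for all }x\in[a,b]_\beta .$$ If $a<s_0<b$, then $$\left|\frac{1}{b-a}\int_a^b f(x)g(x)\,d_\beta x-\frac{1}{(b-a)^2}\int_a^b f(x)\,d_\beta x\int_a^b g(x)\,d_\beta x\right|\le\frac14 (M-m)(N-n)$$ and the constant $\frac14$ is the best possible.
   Context: Setting: $I\subseteq\mathbb{R}$ is an interval, $a,b\in I$, and $\beta:I\to I$ is a strictly increasing continuous function with exactly one fixed point $s_0\in I$, satisfying $(t-s_0)(\beta(t)-t)\le 0$ for all $t\in I$, with equality only if $t=s_0$. Write $\beta^0(t)=t$ and $\beta^k$ for the $k$-fold composition of $\beta$ with itself. The $\beta$-interval is $[a,b]_\beta:=\{\beta^k(a):k\ge 0\}\cup\{\beta^k(b):k\ge 0\}\cup\{s_0\}$. The $\beta$-integral is $\int_a^b h\,d_\beta:=\int_{s_0}^b h\,d_\beta-\int_{s_0}^a h\,d_\beta$, where $\int_{s_0}^x h\,d_\beta:=\sum_{k=0}^{\infty}\big(\beta^k(x)-\beta^{k+1}(x)\big)h\big(\beta^k(x)\big)$; also written $\int_a^b h(x)\,d_\beta x$. The function $h$ is $\beta$-integrable on $[a,b]$ if these series converge for $x=a$ and $x=b$, and absolutely $\beta$-integrable on $[a,b]$ if $|h|$ is $\beta$-integrable on $[a,b]$. *)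

(* Defs.v *)
From HB Require Import structures.
From mathcomp Require Import all_boot all_order all_algebra.
From mathcomp Require Import all_classical all_reals all_analysis.
Set Implicit Arguments.
Unset Strict Implicit.
Unset Printing Implicit Defensive.
Import Order.TTheory GRing.Theory Num.Theory numFieldNormedType.Exports.
Local Open Scope classical_set_scope.
Local Open Scope ring_scope.

(* A function on I (or on [a, b]) is represented by a total function R -> R;
   its values outside the domain are never constrained nor used: for a, b in I
   with a <= s0 <= b the iterates of beta starting at a or b stay in
   [a, b], which is included in I. *)
Record beta_map (R : realType) (I : set R) (beta : R -> R) (s0 : R) : Prop :=
  BetaMap {
    beta_itv : is_interval I;
    beta_stable : forall t, I t -> I (beta t);
    beta_incr : forall t u, I t -> I u -> t < u -> beta t < beta u;
    beta_cont : {within I, continuous beta};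
    beta_fix_in : I s0;
    beta_fix : beta s0 = s0;
    beta_fix_uniq : forall t, I t -> beta t = t -> t = s0;
    beta_le0 : forall t, I t -> (t - s0) * (beta t - t) <= 0;
    beta_eq0 : forall t, I t -> (t - s0) * (beta t - t) = 0 -> t = s0
  }.

Definition beta_interval (R : realType) (beta : R -> R) (s0 a b : R) : set R :=
  range (fun k : nat => iter k beta a) `|` range (fun k : nat => iter k beta b)
  `|` [set s0].

Definition beta_term (R : realType) (beta h : R -> R) (x : R) (k : nat) : R :=
  (iter k beta x - iter k.+1 beta x) * h (iter k beta x).

(* The integral from s0 to x; s0 does not occur in the defining series.
   As usual with lim, this is meaningful only when the series converges. *)
Definition beta_int0 (R : realType) (beta h : R -> R) (x : R) : R :=
  limn (series (beta_term beta h x)).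

Definition beta_int (R : realType) (beta : R -> R) (a b : R) (h : R -> R) : R :=
  beta_int0 beta h b - beta_int0 beta h a.

Definition beta_integrable (R : realType) (beta : R -> R) (a b : R)
    (h : R -> R) : Prop :=
  cvgn (series (beta_term beta h a)) /\ cvgn (series (beta_term beta h b)).

Definition abs_beta_integrable (R : realType) (beta : R -> R) (a b : R)
    (h : R -> R) : Prop :=
  beta_integrable beta a b (fun x => `|h x|).

(* Main.v *)
Require Import Defs.
From HB Require Import structures.
From mathcomp Require Import all_boot all_order all_algebra.
From mathcomp Require Import all_classical all_reals all_analysis.
From mathcomp Require Import ring lra.
Set Implicit Arguments.
Unset Strict Implicit.
Unset Printing Implicit Defensive.
Import Order.TTheory GRing.Theory Num.Theory numFieldNormedType.Exports.
Local Open Scope classical_set_scope.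
Local Open Scope ring_scope.

(** The [beta]-integral from [a] to [b] is a positive linear functional [J] of
    total mass [b - a] on the functions bounded on the orbits of [a] and [b].
    Put [A = J f / (b - a)] and [B = J g / (b - a)].  Applying [J] to
    [(M - f) (g - n) >= 0] and [(f - m) (N - g) >= 0] bounds
    [J (f g) / (b - a) - A B] by both [(M - A) (B - n)] and
    [(A - m) (N - B)], and the product of these two bounds is at most
    [((M - m) (N - n) / 4) ^ 2].  The lower bound follows by replacing [g] with
    [- g].  Equality holds for [f = g] the indicator of [x > s0] on an interval
    centred at [s0]. *)

(** * Orbits of [beta] and convergence of the series along them *)

Section Orbits.
Variables (R : realType) (I : set R) (beta : R -> R) (s0 : R).
Hypothesis hbeta : beta_map I beta s0.

Lemma iter_mem x k : I x -> I (iter k beta x).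
Proof. by move=> Ix; elim: k => //= k; exact: (beta_stable hbeta). Qed.

Lemma beta_gt x : I x -> s0 < x -> s0 < beta x < x.
Proof.
move=> Ix lt_x; apply/andP; split.
  by have := beta_incr hbeta (beta_fix_in hbeta) Ix lt_x; rewrite (beta_fix hbeta).
have := beta_le0 hbeta Ix; rewrite pmulr_rle0 ?subr_gt0// subr_le0 le_eqVlt.
case/orP=> [/eqP eq_x|//].
by have := beta_fix_uniq hbeta Ix eq_x; lra.
Qed.

Lemma beta_lt x : I x -> x < s0 -> x < beta x < s0.
Proof.
move=> Ix lt_x; apply/andP; split; last first.
  by have := beta_incr hbeta Ix (beta_fix_in hbeta) lt_x; rewrite (beta_fix hbeta).
have := beta_le0 hbeta Ix; rewrite nmulr_rle0 ?subr_lt0// subr_ge0 le_eqVlt.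
case/orP=> [/eqP eq_x|//].
by have := beta_fix_uniq hbeta Ix (esym eq_x); lra.
Qed.

Lemma iter_gt x k : I x -> s0 < x -> s0 < iter k beta x.
Proof.
move=> Ix lt_x; elim: k => //= k ihk.
by have /andP[] := beta_gt (iter_mem k Ix) ihk.
Qed.

Lemma iter_lt x k : I x -> x < s0 -> iter k beta x < s0.
Proof.
move=> Ix lt_x; elim: k => //= k ihk.
by have /andP[] := beta_lt (iter_mem k Ix) ihk.
Qed.

(** [beta] moves [x] towards [s0] without crossing it, so a step is as long as the drop in distance
    to [s0]. Sums of step lengths along an orbit therefore telescope on either side of [s0]. *)
Lemma dist_beta x : I x -> `|x - beta x| = `|x - s0| - `|beta x - s0|.
Proof.
move=> Ix; case: (ltgtP x s0) => [lt_x|lt_x|->].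
- have /andP[h1 h2] := beta_lt Ix lt_x.
  by rewrite !ltr0_norm; lra.
- have /andP[h1 h2] := beta_gt Ix lt_x.
  by rewrite !gtr0_norm; lra.
- by rewrite (beta_fix hbeta) !subrr normr0.
Qed.

(** By continuity the limit of an orbit is a fixed point of [beta]. The strict bounds put [l] in an
    open interval inside [I], where continuity within [I] is ordinary continuity at [l]. *)
Lemma orbit_lim a b x l : I a -> I b -> a < l < b ->
  iter k beta x @[k --> \oo] --> l -> l = s0.
Proof.
move=> Ia Ib /andP[al lb] xl.
have subI : [set` `]a, b[] `<=` I.
  move=> y /=; rewrite in_itv/= => /andP[ay yb].
  by apply: (beta_itv hbeta Ia Ib); rewrite (ltW ay) (ltW yb).
have lI : l \in [set` `]a, b[] by rewrite inE/= in_itv/= al lb.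
have := continuous_subspaceW subI (beta_cont hbeta).
rewrite continuous_open_subspace ?itv_open// => /(_ l lI) cl.
apply: (beta_fix_uniq hbeta); first by apply: subI; rewrite inE in lI.
have xbl : beta (iter k beta x) @[k --> \oo] --> beta l.
  by apply: continuous_cvg; [exact: cl|exact: xl].
have := xl; rewrite -cvg_shiftS/= => xl'.
apply: cvg_unique xbl xl'; exact: norm_hausdorff.
Qed.

(** An orbit is monotone and bounded by [s0], hence convergent, and [orbit_lim] identifies its
    limit. *)
Lemma orbit_cvg a b x : I a -> I b -> a < s0 < b -> a <= x <= b ->
  iter k beta x @[k --> \oo] --> s0.
Proof.
move=> Ia Ib /andP[as0 s0b] axb.
have Ix : I x by exact: (beta_itv hbeta Ia Ib).
case/andP: axb => ax xb.
case: (ltgtP x s0) => [lt_x|lt_x|->].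
- have inc : {homo (fun k => iter k beta x) : n m / (n <= m)%N >-> n <= m}.
    apply/nondecreasing_seqP => k /=.
    by have /andP[/ltW] := beta_lt (iter_mem k Ix) (iter_lt k Ix lt_x).
  have ub : forall k, iter k beta x <= s0 by move=> k; exact/ltW/iter_lt.
  have cv : cvgn (fun k => iter k beta x).
    by apply: nondecreasing_is_cvgn => //; exists s0 => _ [k _ <-]; exact: ub.
  suff <- : limn (fun k => iter k beta x) = s0 by [].
  apply: (orbit_lim Ia Ib _ cv); apply/andP; split; last first.
    by apply: le_lt_trans s0b; apply: limr_le => //; exact: nearW.
  (* Index 1 is used because [x] may equal [a]: after one step the orbit is strictly above [a], as
     [orbit_lim] requires. *)
  apply: lt_le_trans (nondecreasing_cvgn_le inc cv 1).
  by apply: le_lt_trans ax _; have /andP[] := beta_lt Ix lt_x.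
- have dec : {homo (fun k => iter k beta x) : n m / (n <= m)%N >-> m <= n}.
    apply/nonincreasing_seqP => k /=.
    by have /andP[_ /ltW] := beta_gt (iter_mem k Ix) (iter_gt k Ix lt_x).
  have lb : forall k, s0 <= iter k beta x by move=> k; exact/ltW/iter_gt.
  have cv : cvgn (fun k => iter k beta x).
    by apply: nonincreasing_is_cvgn => //; exists s0 => _ [k _ <-]; exact: lb.
  suff <- : limn (fun k => iter k beta x) = s0 by [].
  apply: (orbit_lim Ia Ib _ cv); apply/andP; split.
    by apply: lt_le_trans as0 _; apply: limr_ge => //; exact: nearW.
  apply: le_lt_trans (nonincreasing_cvgn_ge dec cv 1) _.
  by apply: lt_le_trans xb; have /andP[] := beta_gt Ix lt_x.
- rewrite (_ : (fun k => iter k beta s0) = cst s0); first exact: cvg_cst.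
  by apply/funext; elim=> //= k ->; rewrite (beta_fix hbeta).
Qed.

Lemma series_beta_term_cst x c : iter k beta x @[k --> \oo] --> s0 ->
  series (beta_term beta (cst c) x) n @[n --> \oo] --> (x - s0) * c.
Proof.
move=> xs0.
rewrite (_ : series _ = fun n => (x - iter n beta x) * c).
  apply: cvgM; last exact: cvg_cst.
  by apply: cvgB; [exact: cvg_cst|exact: xs0].
apply/funext => n; rewrite /series/= /beta_term -mulr_suml; congr (_ * _).
rewrite (eq_bigr (fun k => - iter k.+1 beta x - - iter k beta x)); last first.
  by move=> k _; rewrite opprK addrC.
by rewrite (telescope_sumr (fun k => - iter k beta x)) //= opprK addrC.
Qed.

(** Absolute convergence by comparison with [K] times the step lengths, whose sum telescopes by
    [dist_beta]. *)
Lemma cvg_series_beta_term x h K : I x ->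
  iter k beta x @[k --> \oo] --> s0 ->
  (forall k, `|h (iter k beta x)| <= K) ->
  cvgn (series (beta_term beta h x)).
Proof.
move=> Ix xs0 hK; apply: normed_cvg.
apply: (@series_le_cvg _ _ (fun k => `|iter k beta x - iter k.+1 beta x| * K)).
- by move=> k /=; exact: normr_ge0.
- by move=> k; rewrite mulr_ge0// (le_trans _ (hK 0%N)).
- by move=> k /=; rewrite /beta_term normrM ler_wpM2l.
rewrite (_ : series _ = fun n => (`|x - s0| - `|iter n beta x - s0|) * K).
  apply: is_cvgM; last exact: is_cvg_cst.
  apply: (@cvgP _ _ (`|x - s0| - `|s0 - s0|)); apply: cvgB; first exact: cvg_cst.
  by apply: cvg_norm; apply: cvgB; [exact: xs0 | exact: cvg_cst].
apply/funext => n; rewrite /series/= -mulr_suml; congr (_ * _).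
rewrite (eq_bigr (fun k => - `|iter k.+1 beta x - s0| - - `|iter k beta x - s0|)).
  by rewrite (telescope_sumr (fun k => - `|iter k beta x - s0|)) //= opprK addrC.
by move=> k _; rewrite (dist_beta (iter_mem k Ix)) opprK addrC.
Qed.

End Orbits.

Lemma norm_le_range (R : realDomainType) (y u v : R) :
  u <= y <= v -> `|y| <= `|u| + `|v|.
Proof.
move=> /andP[uy yv]; rewrite ler_norml; apply/andP; split.
  by have := ler_norm (- u); have := normr_ge0 v; rewrite normrN; lra.
by have := ler_norm v; have := normr_ge0 u; lra.
Qed.

(** * The integral as a positive linear functional of mass [b - a] *)

Section Functional.
Variables (R : realType) (I : set R) (beta : R -> R) (s0 : R).
Hypothesis hbeta : beta_map I beta s0.
Variables a b : R.
Hypotheses (Ia : I a) (Ib : I b) (as0 : a < s0) (s0b : s0 < b).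

Local Notation J := (beta_int beta a b).
Local Notation integrable := (beta_integrable beta a b).
Local Notation orbits := (beta_interval beta s0 a b).

Lemma beta_interval_l k : orbits (iter k beta a).
Proof. by left; left; exists k. Qed.

Lemma beta_interval_r k : orbits (iter k beta b).
Proof. by left; right; exists k. Qed.

Lemma iter_cvg_l : iter k beta a @[k --> \oo] --> s0.
Proof.
by apply: (orbit_cvg hbeta Ia Ib); rewrite ?as0 ?s0b// lexx ltW// (lt_trans as0).
Qed.

Lemma iter_cvg_r : iter k beta b @[k --> \oo] --> s0.
Proof.
by apply: (orbit_cvg hbeta Ia Ib); rewrite ?as0 ?s0b// lexx ltW// (lt_trans as0).
Qed.

Lemma bounded_beta_integrable h K :
  (forall x, orbits x -> `|h x| <= K) -> integrable h.
Proof.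
move=> hK; split.
- apply: (cvg_series_beta_term hbeta Ia iter_cvg_l) => k.
  exact/hK/beta_interval_l.
- apply: (cvg_series_beta_term hbeta Ib iter_cvg_r) => k.
  exact/hK/beta_interval_r.
Qed.

Lemma range_beta_integrable h u v :
  (forall x, orbits x -> u <= h x <= v) -> integrable h.
Proof.
move=> huv; apply: (@bounded_beta_integrable _ (`|u| + `|v|)) => x /huv.
exact: norm_le_range.
Qed.

Lemma range_beta_integrableM h1 h2 u1 v1 u2 v2 :
  (forall x, orbits x -> u1 <= h1 x <= v1) ->
  (forall x, orbits x -> u2 <= h2 x <= v2) ->
  integrable (fun x => h1 x * h2 x).
Proof.
move=> h1P h2P.
apply: (@bounded_beta_integrable _ ((`|u1| + `|v1|) * (`|u2| + `|v2|))) => x ox.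
rewrite normrM ler_pM//; apply: norm_le_range; [exact: h1P|exact: h2P].
Qed.

Lemma beta_intN h : integrable h -> J (fun x => - h x) = - J h.
Proof.
move=> [ha hb]; rewrite /beta_int /beta_int0.
have termN x : beta_term beta (fun y => - h y) x = - beta_term beta h x.
  by apply/funext => k; rewrite /beta_term mulrN.
by rewrite !termN !lim_seriesN// opprB opprK addrC.
Qed.

Lemma beta_termZD c h1 h2 x :
  beta_term beta (fun y => c * h1 y + h2 y) x
  = c *: beta_term beta h1 x + beta_term beta h2 x.
Proof.
apply/funext => k.
by rewrite /beta_term !fctE /GRing.scale/=; ring.
Qed.

Lemma beta_integrableZD c h1 h2 : integrable h1 -> integrable h2 ->
  integrable (fun x => c * h1 x + h2 x).
Proof.
move=> [h1a h1b] [h2a h2b]; split; rewrite beta_termZD;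
  by apply: is_cvg_seriesD => //; exact: is_cvg_seriesZ.
Qed.

Lemma beta_intZD c h1 h2 : integrable h1 -> integrable h2 ->
  J (fun x => c * h1 x + h2 x) = c * J h1 + J h2.
Proof.
move=> [h1a h1b] [h2a h2b]; rewrite /beta_int /beta_int0 !beta_termZD.
have zD h h2' : cvgn (series h) -> cvgn (series h2') ->
    limn (series (c *: h + h2')) = c *: limn (series h) + limn (series h2') :> R.
  move=> ch ch2; rewrite lim_seriesD//; last exact: is_cvg_seriesZ.
  by rewrite lim_seriesZ.
rewrite !zD//.
by rewrite /GRing.scale/=; ring.
Qed.

Lemma beta_integrable_cst c : integrable (cst c).
Proof. by apply: (@bounded_beta_integrable _ `|c|) => x _; exact: lexx. Qed.

Lemma beta_int_cst c : J (cst c) = (b - a) * c.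
Proof.
rewrite /beta_int /beta_int0.
rewrite (cvg_lim _ (series_beta_term_cst iter_cvg_l))//.
rewrite (cvg_lim _ (series_beta_term_cst iter_cvg_r))//.
by ring.
Qed.

(** The position of [s0] between [a] and [b] matters here: the steps
    [iter k beta x - iter k.+1 beta x] are positive along the orbit of [b] and negative along that
    of [a], whose series is subtracted. *)
Lemma beta_int_ge0 h : integrable h -> (forall x, orbits x -> 0 <= h x) ->
  0 <= J h.
Proof.
move=> [ha hb] h0; rewrite subr_ge0; apply: (@le_trans _ _ 0).
- apply: limr_le => //; apply: nearW => n.
  rewrite /series/=; apply: sumr_le0 => k _.
  apply: mulr_le0_ge0; last exact/h0/beta_interval_l.
  rewrite subr_le0 iterS ltW//.
  by have /andP[] := beta_lt hbeta (iter_mem hbeta k Ia) (iter_lt hbeta k Ia as0).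
- apply: limr_ge => //; apply: nearW => n.
  rewrite /series/=; apply: sumr_ge0 => k _.
  apply: mulr_ge0; last exact/h0/beta_interval_r.
  rewrite subr_ge0 iterS ltW//.
  by have /andP[] := beta_gt hbeta (iter_mem hbeta k Ib) (iter_gt hbeta k Ib s0b).
Qed.

(** The orbit of [b] stays above [s0] and that of [a] below, so the integrand is constantly 1 on the
    former and 0 on the latter. *)
Lemma beta_int_indic : J (fun x => (s0 < x)%R%:R) = b - s0.
Proof.
rewrite /beta_int /beta_int0.
rewrite (_ : beta_term _ _ b = beta_term beta (cst 1) b); last first.
  by apply/funext => k; rewrite /beta_term (iter_gt hbeta k Ib s0b).
rewrite (_ : beta_term _ _ a = beta_term beta (cst 0) a); last first.
  by apply/funext => k; rewrite /beta_term ltNge (ltW (iter_lt hbeta k Ia as0)).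
rewrite (cvg_lim _ (series_beta_term_cst iter_cvg_l))//.
rewrite (cvg_lim _ (series_beta_term_cst iter_cvg_r))//.
by ring.
Qed.

(** Packages linearity and positivity, so that each pointwise inequality in [f], [g] and [f * g] is
    integrated by giving its coefficients. *)
Lemma beta_int_bilinear f g (c0 c1 c2 c3 : R) :
  integrable f -> integrable g -> integrable (fun x => f x * g x) ->
  (forall x, orbits x -> 0 <= c3 * (f x * g x) + (c1 * f x + (c2 * g x + c0))) ->
  0 <= c3 * J (fun x => f x * g x) + (c1 * J f + (c2 * J g + (b - a) * c0)).
Proof.
move=> jf jg jfg ge0.
have jc := beta_integrable_cst c0.
have j1 := beta_integrableZD c2 jg jc.
have j2 := beta_integrableZD c1 jf j1.
rewrite -beta_int_cst -!beta_intZD//.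
by apply: beta_int_ge0 => //; exact: beta_integrableZD.
Qed.

End Functional.

(** * The upper bound *)

(** For [d > 0], multiplying the two bounds gives [d ^+ 2 <= (x * y) * (p * q)], and the inequality
    of arithmetic and geometric means applies to each factor. *)
Lemma le_quarter_mulD (R : realFieldType) (x y p q d : R) :
  0 <= x -> 0 <= y -> 0 <= p -> 0 <= q -> d <= x * q -> d <= y * p ->
  d <= 4^-1 * (x + y) * (p + q).
Proof.
move=> x0 y0 p0 q0 dxq dyp.
have S0 : 0 <= 4^-1 * (x + y) * (p + q) by rewrite !mulr_ge0 ?addr_ge0 ?invr_ge0.
have [d0|d0] := leP d 0; first exact: le_trans d0 S0.
rewrite -ler_sqr ?nnegrE ?(ltW d0)//.
apply: (@le_trans _ _ ((x * q) * (y * p))).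
  by rewrite expr2 ler_pM// ltW.
have amgm u v : u * v <= 4^-1 * (u + v) ^+ 2 :> R.
  by have := sqr_ge0 (u - v); lra.
rewrite (_ : x * q * (y * p) = (x * y) * (p * q)); last by ring.
rewrite (_ : (_ * _) ^+ 2 =
  (4^-1 * (x + y) ^+ 2) * (4^-1 * (p + q) ^+ 2)); last first.
  by field.
by apply: ler_pM => //; rewrite mulr_ge0.
Qed.

Lemma beta_gruss_le (R : realType) (I : set R) (beta : R -> R) (s0 a b : R)
    (f g : R -> R) (m n M N : R) :
  beta_map I beta s0 -> I a -> I b -> a < s0 -> s0 < b ->
  (forall x, beta_interval beta s0 a b x -> m <= f x <= M) ->
  (forall x, beta_interval beta s0 a b x -> n <= g x <= N) ->
  (b - a)^-1 * beta_int beta a b (fun x => f x * g x)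
  - ((b - a) ^+ 2)^-1 * (beta_int beta a b f * beta_int beta a b g)
  <= 4^-1 * (M - m) * (N - n).
Proof.
move=> hbeta Ia Ib as0 s0b fb gb.
have jf := range_beta_integrable hbeta Ia Ib as0 s0b fb.
have jg := range_beta_integrable hbeta Ia Ib as0 s0b gb.
have jfg := range_beta_integrableM hbeta Ia Ib as0 s0b fb gb.
have pos := beta_int_bilinear hbeta Ia Ib as0 s0b jf jg jfg.
have L0 : 0 < b - a by lra.
move: L0 pos; set F := beta_int _ _ _ f; set G := beta_int _ _ _ g.
set P := beta_int _ _ _ _; set L := b - a => L0 pos.
(* The first four instances of [pos] place the averages of [f] and [g] in [[m, M]] and [[n, N]]; the
   last two expand [(M - f) * (g - n)] and [(f - m) * (N - g)]. *)
have fM : 0 <= 0 * P + (-1 * F + (0 * G + L * M)).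
  by apply: pos => x /fb; lra.
have fm : 0 <= 0 * P + (1 * F + (0 * G + L * - m)).
  by apply: pos => x /fb; lra.
have gN : 0 <= 0 * P + (0 * F + (-1 * G + L * N)).
  by apply: pos => x /gb; lra.
have gn : 0 <= 0 * P + (0 * F + (1 * G + L * - n)).
  by apply: pos => x /gb; lra.
have fMgn : 0 <= -1 * P + (n * F + (M * G + L * - (M * n))).
  apply: pos => x ox; have /andP[_ fxM] := fb x ox; have /andP[gxn _] := gb x ox.
  by nra.
have fmgN : 0 <= -1 * P + (N * F + (m * G + L * - (m * N))).
  apply: pos => x ox; have /andP[fxm _] := fb x ox; have /andP[_ gxN] := gb x ox.
  by nra.
clear pos; clearbody F G P L; move: fM fm gN gn fMgn fmgN.
(* Once [F], [G], [P] are written as [L] times their averages, each bound carries a factor [L > 0],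
   which [cancelL] removes. *)
have LK := mulVKf (lt0r_neq0 L0).
rewrite -(LK F) -(LK G) -(LK P).
move: (L^-1 * F) (L^-1 * G) (L^-1 * P) => A B Q fM fm gN gn fMgn fmgN.
have cancelL u v : v = L * u -> 0 <= v -> 0 <= u.
  by move=> ->; rewrite pmulr_rge0.
have -> : L^-1 * (L * Q) - (L ^+ 2)^-1 * (L * A * (L * B)) = Q - A * B.
  by field; exact: lt0r_neq0.
have -> : 4^-1 * (M - m) * (N - n)
    = 4^-1 * ((M - A) + (A - m)) * ((N - B) + (B - n)).
  by ring.
apply: le_quarter_mulD.
- by apply: cancelL fM; ring.
- by apply: cancelL fm; ring.
- by apply: cancelL gN; ring.
- by apply: cancelL gn; ring.
- by rewrite -subr_ge0; apply: cancelL fMgn; ring.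
- by rewrite -subr_ge0; apply: cancelL fmgN; ring.
Qed.

(** * The two-sided bound and its sharpness *)

Theorem theorem3p1 (R : realType) (I : set R) (beta : R -> R) (s0 : R)
    (hbeta : beta_map I beta s0)
    (a b : R) (ha : I a) (hb : I b) (has0 : a < s0) (hs0b : s0 < b) :
  (forall (f g : R -> R) (m n M N : R),
    abs_beta_integrable beta a b f ->
    abs_beta_integrable beta a b g ->
    (forall x, beta_interval beta s0 a b x -> m <= f x <= M) ->
    (forall x, beta_interval beta s0 a b x -> n <= g x <= N) ->
    `| (b - a)^-1 * beta_int beta a b (fun x => f x * g x)
       - ((b - a) ^+ 2)^-1 * (beta_int beta a b f * beta_int beta a b g) |
      <= 4^-1 * (M - m) * (N - n))
  /\
  (* no constant smaller than 1/4 is valid for all a < s0 < b in I *)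
  (forall C : R,
    (forall (a' b' : R), I a' -> I b' -> a' < s0 -> s0 < b' ->
      forall (f g : R -> R) (m n M N : R),
      abs_beta_integrable beta a' b' f ->
      abs_beta_integrable beta a' b' g ->
      (forall x, beta_interval beta s0 a' b' x -> m <= f x <= M) ->
      (forall x, beta_interval beta s0 a' b' x -> n <= g x <= N) ->
      `| (b' - a')^-1 * beta_int beta a' b' (fun x => f x * g x)
         - ((b' - a') ^+ 2)^-1 * (beta_int beta a' b' f * beta_int beta a' b' g) |
        <= C * (M - m) * (N - n)) ->
    4^-1 <= C).
Proof.
split=> [f g m n M N [fa fb] [ga gb] fM gN|C sharp].
- have up := beta_gruss_le hbeta ha hb has0 hs0b fM gN.
  rewrite ler_norml up andbT lerNl.
  (* Negating [g] negates the difference to be bounded and keeps the width [N - n] of the range. *)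
  have gN' x : beta_interval beta s0 a b x -> - N <= - g x <= - n.
    by move=> /gN /andP[h1 h2]; rewrite !lerN2 h1 h2.
  have := beta_gruss_le hbeta ha hb has0 hs0b fM gN'.
  rewrite (_ : (fun x => f x * - g x) = fun x => - (f x * g x)); last first.
    by apply/funext => x; rewrite mulrN.
  rewrite (beta_intN (range_beta_integrable hbeta ha hb has0 hs0b gN)).
  rewrite (beta_intN (range_beta_integrableM hbeta ha hb has0 hs0b fM gN)).
  lra.
(* The largest radius for which the interval centred at [s0] stays in [[a, b]], hence in [I]. *)
- pose d := Num.min (s0 - a) (b - s0).
  have d0 : 0 < d by rewrite lt_min !subr_gt0 has0.
  have da : d <= s0 - a by rewrite ge_min lexx.
  have db : d <= b - s0 by rewrite ge_min lexx orbT.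
  have Ia' : I (s0 - d) by apply: (beta_itv hbeta ha hb); lra.
  have Ib' : I (s0 + d) by apply: (beta_itv hbeta ha hb); lra.
  have lt1 : s0 - d < s0 by lra.
  have lt2 : s0 < s0 + d by lra.
  pose f x : R := (s0 < x)%R%:R.
  have f01 x : 0 <= f x <= 1 by rewrite /f; case: ltP => _ /=; lra.
  have jf : abs_beta_integrable beta (s0 - d) (s0 + d) f.
    apply: (bounded_beta_integrable hbeta Ia' Ib' lt1 lt2 (K := 1)) => x _.
    by have /andP[f0 f1] := f01 x; rewrite normr_id ger0_norm.
  have := sharp _ _ Ia' Ib' lt1 lt2 f f 0 0 1 1 jf jf
    (fun x _ => f01 x) (fun x _ => f01 x).
  (* The indicator is idempotent, and both it and its square have average 1/2 on the centred
     interval: the difference is 1/2 - 1/4. *)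
  rewrite (_ : (fun x => f x * f x) = f); last first.
    by apply/funext => x; rewrite /f; case: ltP; rewrite ?mulr1 ?mulr0.
  rewrite (beta_int_indic hbeta Ia' Ib' lt1 lt2).
  have -> : (s0 + d - (s0 - d))^-1 * (s0 + d - s0)
      - ((s0 + d - (s0 - d)) ^+ 2)^-1 * ((s0 + d - s0) * (s0 + d - s0)) = 4^-1.
    by field; rewrite ?andbT; apply/eqP; lra.
  by rewrite ger0_norm ?invr_ge0// subr0 !mulr1.
Qed.
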